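(* Let $\mathcal{A}$ be an abelian category, let $\mathcal{A}^\square$ be the category of monos of $\mathcal{A}$, and let $\mathcal{B}$ be an abelian category. The functor $$T\mapsto H^T:\ \underline{\mathsf{Hom}}_\partial(\mathcal{A},\mathcal{B})\hookrightarrow\underline{\mathsf{Hom}}_{\rm add}(\mathcal{A}^\square,\mathcal{B}),$$ given by $H_i^T(A,B):=T_i(A/B)$, is fully faithful with essential image the subcategory of $\partial$-homologies.
   Context: $\underline{\mathsf{Hom}}_\partial(\mathcal{A},\mathcal{B})$ is the category of Grothendieck homological functors ($\mathbb{Z}$-indexed exact covariant $\partial^*$-functors): families $T=\{T_i\}_{i\in\mathbb{Z}}$ of additive functors $T_i:\mathcal{A}\to\mathcal{B}$ with boundary morphisms $\partial_i:T_i(C)\to T_{i-1}(B)$ for each short exact sequence $0\to B\to A\to C\to0$, natural in the sequence, such that $\cdots\to T_i(B)\to T_i(A)\to T_i(C)\xrightarrow{\partial_i}T_{i-1}(B)\to\cdots$ is exact; morphisms are families of natural transformations commuting with the boundaries. $\mathcal{A}^\square$: an object $(A,B)$ is a mono $B\hookrightarrow A$ of $\mathcal{A}$, a morphism $(A,B)\to(A',B')$ is a commutative square. For monos $C\hookrightarrow B\hookrightarrow A$ one has the triple $(A,B),(A,C),(B,C)$ with evident morphisms $(B,C)\xrightarrow{\alpha}(A,C)\xrightarrow{\beta}(A,B)$. A relative homology on $\mathcal{A}^\square$ with values in $\mathcal{B}$ is a family of functors $H_i:\mathcal{A}^\square\to\mathcal{B}$, $i\in\mathbb{Z}$, with morphisms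 $\partial_i:H_i(A,B)\to H_{i-1}(B,C)$ for each triple, such that $\cdots\to H_i(B,C)\xrightarrow{\alpha_i}H_i(A,C)\xrightarrow{\beta_i}H_i(A,B)\xrightarrow{\partial_i}H_{i-1}(B,C)\to\cdots$ is exact, and $\gamma_{i-1}\partial_i=\partial_i'\delta_i$ whenever $\gamma:(B,C)\to(B',C')$, $\delta:(A,B)\to(A',B')$ satisfy $\delta\beta\alpha=\beta'\alpha'\gamma$. Morphisms are families of natural transformations commuting with all $\partial_i$. Write $H_i(A):=H_i(A,0)$. $H$ is finitely additive if $H_i(A)\oplus H_i(A')\to H_i(A\oplus A')$ is an isomorphism for all $A,A'$ and $i$; these form $\underline{\mathsf{Hom}}_{\rm add}(\mathcal{A}^\square,\mathcal{B})$. A $\partial$-homology is a finitely additive relative homology such that the canonical morphism $H_i(A,B)\to H_i(A/B)$, induced by $(A,B)\to(A/B,0)$, is an isomorphism for all $(A,B)\in\mathcal{A}^\square$ and $i$. For $T\in\underline{\mathsf{Hom}}_\partial(\mathcal{A},\mathcal{B})$ the connecting morphisms of $H^T$ for a triple are the boundaries of $T$ for $0\to B/C\to A/C\to A/B\to0$. *)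

(* Defs.v *)
From HB Require Import structures.
From mathcomp Require Import all_boot ssralg ssrint.
From mathcomp Require Import boolp.

Set Implicit Arguments.
Unset Strict Implicit.
Unset Printing Implicit Defensive.

Import GRing.Theory.
Local Open Scope ring_scope.
Local Obligation Tactic := idtac.

Reserved Notation "g \oc f" (at level 40, left associativity).

Record category := Category {
  obj :> Type;
  hom : obj -> obj -> Type;
  idc : forall X, hom X X;
  compc : forall X Y Z, hom Y Z -> hom X Y -> hom X Z;
  comp1c : forall X Y (f : hom X Y), compc (idc Y) f = f;
  compc1 : forall X Y (f : hom X Y), compc f (idc X) = f;
  compcA : forall X Y Z W (h : hom Z W) (g : hom Y Z) (f : hom X Y),
    compc h (compc g f) = compc (compc h g) f
}.
Arguments hom {c} X Y.
Arguments idc {c} X.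
Arguments compc {c X Y Z} g f.
Notation "g \oc f" := (compc g f).

Section CategoryTheory.
Context {C : category}.
Implicit Types X Y Z : C.

Definition monic X Y (f : hom X Y) :=
  forall Z (u v : hom Z X), f \oc u = f \oc v -> u = v.

Definition epic X Y (f : hom X Y) :=
  forall Z (u v : hom Y Z), u \oc f = v \oc f -> u = v.

Definition is_iso X Y (f : hom X Y) :=
  exists g : hom Y X, g \oc f = idc X /\ f \oc g = idc Y.

Definition isomorphic X Y := exists f : hom X Y, is_iso f.

End CategoryTheory.

Record functor (C D : category) := Functor {
  fobj :> C -> D;
  fmap : forall X Y : C, hom X Y -> hom (fobj X) (fobj Y);
  fmap1 : forall X, fmap (idc X) = idc (fobj X);
  fmapM : forall X Y Z (g : hom Y Z) (f : hom X Y),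
    fmap (g \oc f) = fmap g \oc fmap f
}.
Arguments fmap {C D} f {X Y} _ : rename.

Program Definition functor_comp (C D E : category)
    (G : functor D E) (F : functor C D) : functor C E :=
  @Functor C E (fun X => G (F X)) (fun X Y f => fmap G (fmap F f)) _ _.
Next Obligation. by move=> C D E G F X; rewrite /= !fmap1. Qed.
Next Obligation. by move=> C D E G F X Y Z g f; rewrite /= !fmapM. Qed.

Record nat_trans (C D : category) (F G : functor C D) := NatTrans {
  nt :> forall X : C, hom (F X) (G X);
  ntP : forall X Y (f : hom X Y), nt Y \oc fmap F f = fmap G f \oc nt X
}.

Program Definition nat_trans_id (C D : category) (F : functor C D) :
    nat_trans F F :=
  @NatTrans C D F F (fun X => idc (F X)) _.
Next Obligation. by move=> C D F X Y f; rewrite /= comp1c compc1. Qed.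

Program Definition nat_trans_comp (C D : category) (F G H : functor C D)
    (t : nat_trans G H) (s : nat_trans F G) : nat_trans F H :=
  @NatTrans C D F H (fun X => t X \oc s X) _.
Next Obligation.
by move=> C D F G H t s X Y f; rewrite /= -compcA ntP compcA ntP compcA.
Qed.

Lemma nat_trans_eq (C D : category) (F G : functor C D) (s t : nat_trans F G) :
  (forall X, s X = t X) -> s = t.
Proof.
case: s t => [s sP] [t tP] /= st.
have e : s = t by apply: functional_extensionality_dep.
by case: _ / e in tP *; congr NatTrans; exact: Prop_irrelevance.
Qed.

Section FunctorProperties.
Context {C D : category} (F : functor C D).

Definition faithful := forall X Y (f g : hom X Y), fmap F f = fmap F g -> f = g.

Definition full :=
  forall X Y (g : hom (F X) (F Y)), exists f : hom X Y, fmap F f = g.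

Definition fully_faithful := full /\ faithful.

Definition in_essential_image (Y : D) := exists X : C, isomorphic (F X) Y.

End FunctorProperties.

(* The abelian group structure on hom-sets is given by the class record of
   zmodType, so that the additive notations and lemmas apply to [hom X Y]. *)
Record preadditive := Preadditive {
  pcat :> category;
  pclass : forall X Y : pcat, GRing.Zmodule (hom X Y);
  pcompDl : forall (X Y Z : pcat) (g h : hom Y Z) (f : hom X Y),
    let addXZ := GRing.Zmodule.Pack (pclass X Z) in
    let addYZ := GRing.Zmodule.Pack (pclass Y Z) in
    ((g : addYZ) + h : addYZ) \oc f = (g \oc f : addXZ) + (h \oc f);
  pcompDr : forall (X Y Z : pcat) (g : hom Y Z) (f h : hom X Y),
    let addXZ := GRing.Zmodule.Pack (pclass X Z) in
    let addXY := GRing.Zmodule.Pack (pclass X Y) in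
    g \oc ((f : addXY) + h : addXY) = (g \oc f : addXZ) + (g \oc h)
}.

HB.instance Definition _ (P : preadditive) (X Y : P) :=
  GRing.Zmodule.copy (@hom (pcat P) X Y) (GRing.Zmodule.Pack (pclass X Y)).

Section Preadditive.
Context {P : preadditive}.
Implicit Types X Y Z K Q : P.

Lemma compcDl X Y Z (g h : hom Y Z) (f : hom X Y) :
  (g + h) \oc f = g \oc f + h \oc f.
Proof. exact: pcompDl. Qed.

Lemma compcDr X Y Z (g : hom Y Z) (f h : hom X Y) :
  g \oc (f + h) = g \oc f + g \oc h.
Proof. exact: pcompDr. Qed.

Lemma comp0c X Y Z (f : hom X Y) : (0 : hom Y Z) \oc f = 0.
Proof. by apply: (addrI ((0 : hom Y Z) \oc f)); rewrite -compcDl !addr0. Qed.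

Lemma compc0 X Y Z (g : hom Y Z) : g \oc (0 : hom X Y) = 0.
Proof. by apply: (addrI (g \oc (0 : hom X Y))); rewrite -compcDr !addr0. Qed.

Lemma compcN X Y Z (g : hom Y Z) (f : hom X Y) : g \oc (- f) = - (g \oc f).
Proof. by apply: (addrI (g \oc f)); rewrite -compcDr !subrr compc0. Qed.

Lemma compNc X Y Z (g : hom Y Z) (f : hom X Y) : (- g) \oc f = - (g \oc f).
Proof. by apply: (addrI (g \oc f)); rewrite -compcDl !subrr comp0c. Qed.

Definition is_kernel X Y (f : hom X Y) K (k : hom K X) :=
  f \oc k = 0 /\
  forall Z (h : hom Z X), f \oc h = 0 -> exists! u : hom Z K, k \oc u = h.

Definition is_cokernel X Y (f : hom X Y) Q (q : hom Y Q) :=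
  q \oc f = 0 /\
  forall Z (h : hom Y Z), h \oc f = 0 -> exists! u : hom Q Z, u \oc q = h.

End Preadditive.

(* Zero object, biproducts, kernels and cokernels are part of the data, so
   that A / B below is the given cokernel of B >-> A. *)
Record abelian := Abelian {
  ab_preadditive :> preadditive;
  zeroob : ab_preadditive;
  from_zero : forall (X : ab_preadditive) (f : hom zeroob X), f = 0;
  to_zero : forall (X : ab_preadditive) (f : hom X zeroob), f = 0;
  biprod : ab_preadditive -> ab_preadditive -> ab_preadditive;
  inj1 : forall X Y, hom X (biprod X Y);
  inj2 : forall X Y, hom Y (biprod X Y);
  prj1 : forall X Y, hom (biprod X Y) X;
  prj2 : forall X Y, hom (biprod X Y) Y;
  prj1_inj1 : forall X Y, prj1 X Y \oc inj1 X Y = idc X;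
  prj2_inj2 : forall X Y, prj2 X Y \oc inj2 X Y = idc Y;
  biprodP : forall X Y,
    inj1 X Y \oc prj1 X Y + inj2 X Y \oc prj2 X Y = idc (biprod X Y);
  ker : forall X Y : ab_preadditive, hom X Y -> ab_preadditive;
  kerm : forall (X Y : ab_preadditive) (f : hom X Y), hom (ker f) X;
  kermP : forall (X Y : ab_preadditive) (f : hom X Y), is_kernel f (kerm f);
  coker : forall X Y : ab_preadditive, hom X Y -> ab_preadditive;
  cokerm : forall (X Y : ab_preadditive) (f : hom X Y), hom Y (coker f);
  cokermP : forall (X Y : ab_preadditive) (f : hom X Y),
    is_cokernel f (cokerm f);
  monic_normal : forall (X Y : ab_preadditive) (f : hom X Y), monic f ->
    exists (Z : ab_preadditive) (g : hom Y Z), is_kernel g f;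
  epic_normal : forall (X Y : ab_preadditive) (f : hom X Y), epic f ->
    exists (Z : ab_preadditive) (g : hom Z X), is_cokernel g f
}.
Arguments zeroob {a}.
Arguments inj1 {a} X Y.
Arguments inj2 {a} X Y.
Arguments prj1 {a} X Y.
Arguments prj2 {a} X Y.

Section Abelian.
Context {A : abelian}.
Implicit Types X Y Z : A.

Definition copair X Y Z (f : hom X Z) (g : hom Y Z) : hom (biprod X Y) Z :=
  f \oc prj1 X Y + g \oc prj2 X Y.

(* The image subobject of f is Ker (Coker f). *)
Definition imm X Y (f : hom X Y) : hom (ker (cokerm f)) Y := kerm (cokerm f).

(* X -f-> Y -g-> Z is exact at Y when im f = ker g as subobjects of Y, that is
   when the image of f is a kernel of g. *)
Definition exact_at X Y Z (f : hom X Y) (g : hom Y Z) := is_kernel g (imm f).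

Definition short_exact X Y Z (f : hom X Y) (g : hom Y Z) :=
  [/\ exact_at (0 : hom zeroob X) f, exact_at f g & exact_at g (0 : hom Z zeroob)].

Lemma is_kernel_monic X Y (f : hom X Y) K (k : hom K X) :
  is_kernel f k -> monic k.
Proof.
move=> [fk0 kU] Z u v e.
have [|w [_ wU]] := kU Z (k \oc u); first by rewrite compcA fk0 comp0c.
by rewrite -(wU u) // -(wU v).
Qed.

Lemma is_cokernel_epic X Y (f : hom X Y) Q (q : hom Y Q) :
  is_cokernel f q -> epic q.
Proof.
move=> [qf0 qU] Z u v e.
have [|w [_ wU]] := qU Z (u \oc q); first by rewrite -compcA qf0 compc0.
by rewrite -(wU u) // -(wU v).
Qed.

Lemma monic0 X Y Z (f : hom X Y) (u : hom Z X) :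
  monic f -> f \oc u = 0 -> u = 0.
Proof. by move=> fm fu; apply: fm; rewrite fu compc0. Qed.

Lemma epic0 X Y Z (f : hom X Y) (u : hom Y Z) :
  epic f -> u \oc f = 0 -> u = 0.
Proof. by move=> fe fu; apply: fe; rewrite fu comp0c. Qed.

Lemma zero_monic X (f : hom zeroob X) : monic f.
Proof. by move=> Z u v _; rewrite (to_zero u) (to_zero v). Qed.

Lemma monic_comp X Y Z (g : hom Y Z) (f : hom X Y) :
  monic g -> monic f -> monic (g \oc f).
Proof. by move=> gm fm W u v; rewrite -!compcA => /gm /fm. Qed.

Lemma epic_comp X Y Z (g : hom Y Z) (f : hom X Y) :
  epic g -> epic f -> epic (g \oc f).
Proof. by move=> ge fe W u v; rewrite !compcA => /fe /ge. Qed.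

Lemma is_kernel_cokerm X Y (f : hom X Y) :
  monic f -> is_kernel (cokerm f) f.
Proof.
move=> fm; have [Z [g [gf0 gU]]] := monic_normal fm.
have [cf0 cU] := cokermP f; split=> // W h ch0.
have [w [wc _]] := cU _ _ gf0.
by apply: gU; rewrite -wc -compcA ch0 compc0.
Qed.

Lemma is_cokernel_kernel X Y (q : hom X Y) K (k : hom K X) :
  epic q -> is_kernel q k -> is_cokernel k q.
Proof.
move=> qe [qk0 kU]; have [Z [g [qg0 qU]]] := epic_normal qe.
split=> // W h hk0; apply: qU; have [w [kw _]] := kU _ _ qg0.
by rewrite -kw compcA hk0 comp0c.
Qed.

Lemma imm_epic X Y (f : hom X Y) (e : hom X (ker (cokerm f))) :
  imm f \oc e = f -> epic e.
Proof.
move=> fe; have nm : monic (imm f) := is_kernel_monic (kermP _).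
suff H W (t : hom (ker (cokerm f)) W) : t \oc e = 0 -> t = 0.
  move=> W u v uv; apply/eqP; rewrite -subr_eq0; apply/eqP/H.
  by rewrite compcDl compNc uv subrr.
move=> te0; have [ts0 sU] := kermP t; set s := kerm t in ts0 sU.
have sm : monic s := is_kernel_monic (kermP _).
have [e' [se' _]] := sU _ _ te0.
have [wn0 wU] := is_kernel_cokerm (monic_comp nm sm).
have wf0 : cokerm (imm f \oc s) \oc f = 0.
  rewrite -[RHS](comp0c _ e') -wn0 -compcA; congr (_ \oc _).
  by rewrite -compcA se' fe.
have [w' [ww' _]] := (cokermP f).2 _ _ wf0.
have [|u [nu _]] := wU _ (imm f).
  by rewrite -ww' -compcA (kermP (cokerm f)).1 compc0.
have su1 : s \oc u = idc _ by apply: nm; rewrite compcA nu compc1.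
by rewrite -(compc1 t) -su1 compcA ts0 comp0c.
Qed.

Lemma exact_cokernel X Y Z (f : hom X Y) (g : hom Y Z) :
  is_cokernel f g -> exact_at f g.
Proof.
move=> [gf0 gU]; have [cf0 cU] := cokermP f.
have [u [uc _]] := cU _ _ gf0; have [v [vg _]] := gU _ _ cf0.
have [ck0 kU] := kermP (cokerm f).
split=> [|W h gh0]; first by rewrite -uc -compcA ck0 compc0.
by apply: kU; rewrite -vg -compcA gh0 compc0.
Qed.

Lemma exact_monic X Y (f : hom X Y) :
  monic f -> exact_at (0 : hom zeroob X) f.
Proof.
move=> fm; have [_ cU] := cokermP (0 : hom zeroob X).
have [u [uc _]] := cU _ (idc X) (compc0 _ _).
have nm : monic (imm (0 : hom zeroob X)) := is_kernel_monic (kermP _).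
have n0 : imm (0 : hom zeroob X) = 0.
  by rewrite -(comp1c (imm _)) -uc -compcA (kermP (cokerm _)).1 compc0.
split=> [|Z h /(monic0 fm) ->]; first by rewrite n0 compc0.
by exists 0; split=> [|v nv]; [rewrite compc0 | apply: nm; rewrite nv compc0].
Qed.

Lemma exact_epic X Y (g : hom X Y) :
  epic g -> exact_at g (0 : hom Y zeroob).
Proof.
move=> ge; have c0 : cokerm g = 0 := epic0 ge (cokermP g).1.
split=> [|Z h _]; first exact: to_zero.
by apply: (kermP (cokerm g)).2; rewrite c0 comp0c.
Qed.

(* The morphism out of the chosen cokernel induced by h. *)
Definition cokdesc X Y (f : hom X Y) Z (h : hom Y Z) (hf0 : h \oc f = 0) :
  hom (coker f) Z := projT1 (cid ((cokermP f).2 Z h hf0)).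

Lemma cokdescK X Y (f : hom X Y) Z (h : hom Y Z) (hf0 : h \oc f = 0) :
  cokdesc hf0 \oc cokerm f = h.
Proof. by rewrite /cokdesc; case: cid => u [/=]. Qed.

Lemma cokerm_epic X Y (f : hom X Y) : epic (cokerm f).
Proof. exact: is_cokernel_epic (cokermP f). Qed.

End Abelian.

Section Square.
Variable A : abelian.

(* The pair (A, B) is represented by the mono [sq_inc : B -> A]. *)
Record sq_obj := SqObj {
  sq_big : A;
  sq_sub : A;
  sq_inc : hom sq_sub sq_big;
  sq_incP : monic sq_inc
}.

Record sq_hom (X Y : sq_obj) := SqHom {
  sq_top : hom (sq_big X) (sq_big Y);
  sq_bot : hom (sq_sub X) (sq_sub Y);
  sq_comm : sq_top \oc sq_inc X = sq_inc Y \oc sq_bot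
}.

Lemma sq_hom_eq X Y (f g : sq_hom X Y) :
  sq_top f = sq_top g -> sq_bot f = sq_bot g -> f = g.
Proof.
case: f g => [f f' fP] [g g' gP] /= e e'; case: _ / e in gP *.
by case: _ / e' in gP *; congr SqHom; exact: Prop_irrelevance.
Qed.

Program Definition sq_id X : sq_hom X X := @SqHom X X (idc _) (idc _) _.
Next Obligation. by move=> X; rewrite comp1c compc1. Qed.

Program Definition sq_comp X Y Z (g : sq_hom Y Z) (f : sq_hom X Y) :
  sq_hom X Z := @SqHom X Z (sq_top g \oc sq_top f) (sq_bot g \oc sq_bot f) _.
Next Obligation.
by move=> X Y Z g f; rewrite -compcA sq_comm compcA sq_comm compcA.
Qed.

Program Definition square : category :=
  @Category sq_obj sq_hom sq_id sq_comp _ _ _.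
Next Obligation. by move=> X Y f; apply: sq_hom_eq; rewrite /= comp1c. Qed.
Next Obligation. by move=> X Y f; apply: sq_hom_eq; rewrite /= compc1. Qed.
Next Obligation. by move=> *; apply: sq_hom_eq; rewrite /= compcA. Qed.

(* X |-> (X, 0). *)
Definition sq0_obj (X : A) : square :=
  SqObj (@zero_monic A X 0).

Program Definition sq0_hom (X Y : A) (f : hom X Y) :
  @hom square (sq0_obj X) (sq0_obj Y) :=
  @SqHom (sq0_obj X) (sq0_obj Y) f (idc zeroob) _.
Next Obligation. by move=> X Y f; rewrite /= compc0 comp0c. Qed.

Program Definition sq0 : functor A square :=
  @Functor A square sq0_obj sq0_hom _ _.
Next Obligation. by move=> X; apply: sq_hom_eq. Qed.
Next Obligation. by move=> X Y Z g f; apply: sq_hom_eq; rewrite //= compc1. Qed.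

Record triple := Triple {
  tA : A;
  tB : A;
  tC : A;
  tBA : hom tB tA;
  tCB : hom tC tB;
  tBAP : monic tBA;
  tCBP : monic tCB
}.

Definition pAB (t : triple) : square := SqObj (@tBAP t).
Definition pBC (t : triple) : square := SqObj (@tCBP t).
Definition pAC (t : triple) : square :=
  SqObj (monic_comp (@tBAP t) (@tCBP t)).

Program Definition alpha (t : triple) : hom (pBC t) (pAC t) :=
  @SqHom (pBC t) (pAC t) (tBA t) (idc (tC t)) _.
Next Obligation. by move=> t; rewrite /= compc1. Qed.

Program Definition beta (t : triple) : hom (pAC t) (pAB t) :=
  @SqHom (pAC t) (pAB t) (idc (tA t)) (tCB t) _.
Next Obligation. by move=> t; rewrite /= comp1c. Qed.

End Square.

Definition additive_functor (A B : abelian) (F : functor A B) :=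
  forall (X Y : A) (f g : hom X Y), fmap F (f + g) = fmap F f + fmap F g.

Record ses (A : abelian) := Ses {
  sesB : A;
  sesA : A;
  sesC : A;
  sesi : hom sesB sesA;
  sesp : hom sesA sesC;
  sesP : short_exact sesi sesp
}.

Record ses_hom (A : abelian) (s s' : ses A) := SesHom {
  shB : hom (sesB s) (sesB s');
  shA : hom (sesA s) (sesA s');
  shC : hom (sesC s) (sesC s');
  shi : shA \oc sesi s = sesi s' \oc shB;
  shp : shC \oc sesp s = sesp s' \oc shA
}.

(* Grothendieck's exact covariant d^*-functors, indexed by the integers; the
   suffix [bd] refers to the boundary maps. *)
Record hom_functor (A B : abelian) := HomFunctor {
  hf :> int -> functor A B;
  hf_additive : forall i : int, additive_functor (hf i);
  hfbd : forall (i : int) (s : ses A),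
    hom (hf i (sesC s)) (hf (i - 1) (sesB s));
  hfbd_nat : forall (i : int) (s s' : ses A) (u : ses_hom s s'),
    fmap (hf (i - 1)) (shB u) \oc hfbd i s = hfbd i s' \oc fmap (hf i) (shC u);
  hf_exactA : forall (i : int) s,
    exact_at (fmap (hf i) (sesi s)) (fmap (hf i) (sesp s));
  hf_exactC : forall (i : int) s,
    exact_at (fmap (hf i) (sesp s)) (hfbd i s);
  hf_exactB : forall (i : int) s,
    exact_at (hfbd i s) (fmap (hf (i - 1)) (sesi s))
}.

Record hf_hom (A B : abelian) (T S : hom_functor A B) := HfHom {
  hfm :> forall i : int, nat_trans (T i) (S i);
  hfmP : forall (i : int) (s : ses A),
    hfm (i - 1) (sesB s) \oc hfbd T i s = hfbd S i s \oc hfm i (sesC s)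
}.

Lemma hf_hom_eq (A B : abelian) (T S : hom_functor A B) (m n : hf_hom T S) :
  (forall i X, m i X = n i X) -> m = n.
Proof.
case: m n => [m mP] [n nP] /= mn.
have e : m = n.
  by apply: functional_extensionality_dep => i; apply: nat_trans_eq.
by case: _ / e in nP *; congr HfHom; exact: Prop_irrelevance.
Qed.

Program Definition hf_hom_id (A B : abelian) (T : hom_functor A B) :
  hf_hom T T := @HfHom A B T T (fun i => nat_trans_id (T i)) _.
Next Obligation. by move=> *; rewrite /= comp1c compc1. Qed.

Program Definition hf_hom_comp (A B : abelian) (T S U : hom_functor A B)
    (m : hf_hom S U) (n : hf_hom T S) : hf_hom T U :=
  @HfHom A B T U (fun i => nat_trans_comp (m i) (n i)) _.
Next Obligation.
by move=> A B T S U m n i s; rewrite /= -compcA hfmP [RHS]compcA -(hfmP m) compcA.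
Qed.

Program Definition Hom_bd (A B : abelian) : category :=
  @Category (hom_functor A B) (@hf_hom A B) (@hf_hom_id A B) (@hf_hom_comp A B)
    _ _ _.
Next Obligation. by move=> *; apply: hf_hom_eq => i Z; rewrite /= comp1c. Qed.
Next Obligation. by move=> *; apply: hf_hom_eq => i Z; rewrite /= compc1. Qed.
Next Obligation. by move=> *; apply: hf_hom_eq => i ?; rewrite /= compcA. Qed.

Record rel_homology (A B : abelian) := RelHomology {
  rh :> int -> functor (square A) B;
  rhbd : forall (i : int) (t : triple A),
    hom (rh i (pAB t)) (rh (i - 1) (pBC t));
  rhbd_nat : forall (i : int) (t t' : triple A)
      (c : hom (pBC t) (pBC t')) (d : hom (pAB t) (pAB t')),
    d \oc beta t \oc alpha t = beta t' \oc alpha t' \oc c ->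
    fmap (rh (i - 1)) c \oc rhbd i t = rhbd i t' \oc fmap (rh i) d;
  rh_exactAC : forall (i : int) t,
    exact_at (fmap (rh i) (alpha t)) (fmap (rh i) (beta t));
  rh_exactAB : forall (i : int) t,
    exact_at (fmap (rh i) (beta t)) (rhbd i t);
  rh_exactBC : forall (i : int) t,
    exact_at (rhbd i t) (fmap (rh (i - 1)) (alpha t))
}.

Record rh_hom (A B : abelian) (H K : rel_homology A B) := RhHom {
  rhm :> forall i : int, nat_trans (H i) (K i);
  rhmP : forall (i : int) (t : triple A),
    rhm (i - 1) (pBC t) \oc rhbd H i t = rhbd K i t \oc rhm i (pAB t)
}.

Lemma rh_hom_eq (A B : abelian) (H K : rel_homology A B) (m n : rh_hom H K) :
  (forall i X, m i X = n i X) -> m = n.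
Proof.
case: m n => [m mP] [n nP] /= mn.
have e : m = n.
  by apply: functional_extensionality_dep => i; apply: nat_trans_eq.
by case: _ / e in nP *; congr RhHom; exact: Prop_irrelevance.
Qed.

Program Definition rh_hom_id (A B : abelian) (H : rel_homology A B) :
  rh_hom H H := @RhHom A B H H (fun i => nat_trans_id (H i)) _.
Next Obligation. by move=> *; rewrite /= comp1c compc1. Qed.

Program Definition rh_hom_comp (A B : abelian) (H K L : rel_homology A B)
    (m : rh_hom K L) (n : rh_hom H K) : rh_hom H L :=
  @RhHom A B H L (fun i => nat_trans_comp (m i) (n i)) _.
Next Obligation.
by move=> A B H K L m n i t; rewrite /= -compcA rhmP [RHS]compcA -(rhmP m) compcA.
Qed.

Definition finitely_additive (A B : abelian) (H : rel_homology A B) :=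
  forall (i : int) (X Y : A),
    is_iso (copair (fmap (H i) (fmap (sq0 A) (inj1 X Y)))
                   (fmap (H i) (fmap (sq0 A) (inj2 X Y)))).

Record add_homology (A B : abelian) := AddHomology {
  ah :> rel_homology A B;
  ahP : finitely_additive ah
}.

Program Definition Hom_add (A B : abelian) : category :=
  @Category (add_homology A B) (fun H K => rh_hom H K)
    (fun H => rh_hom_id H) (fun H K L => @rh_hom_comp A B H K L) _ _ _.
Next Obligation. by move=> *; apply: rh_hom_eq => i Z; rewrite /= comp1c. Qed.
Next Obligation. by move=> *; apply: rh_hom_eq => i Z; rewrite /= compc1. Qed.
Next Obligation. by move=> *; apply: rh_hom_eq => i ?; rewrite /= compcA. Qed.

Section Quotient.
Variable A : abelian.

Definition quo_obj (X : square A) : A := coker (sq_inc X).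

Lemma quo_subproof (X Y : square A) (f : hom X Y) :
  cokerm (sq_inc Y) \oc sq_top f \oc sq_inc X = 0.
Proof. by rewrite -compcA sq_comm compcA (cokermP _).1 comp0c. Qed.

Definition quo_hom (X Y : square A) (f : hom X Y) :
  hom (quo_obj X) (quo_obj Y) := cokdesc (quo_subproof f).

Lemma quo_homE (X Y : square A) (f : hom X Y) :
  quo_hom f \oc cokerm (sq_inc X) = cokerm (sq_inc Y) \oc sq_top f.
Proof. exact: cokdescK. Qed.

(* (A, B) |-> A / B. *)
Program Definition quo : functor (square A) A :=
  @Functor (square A) A quo_obj quo_hom _ _.
Next Obligation.
by move=> X; apply: cokerm_epic; rewrite quo_homE /= compc1 comp1c.
Qed.
Next Obligation.
move=> X Y Z g f; apply: cokerm_epic.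
by rewrite quo_homE /= -compcA quo_homE !compcA quo_homE.
Qed.

(* The projection (A, B) -> (A / B, 0). *)
Program Definition sq_proj (X : square A) : hom X (sq0 A (quo X)) :=
  @SqHom A X (sq0 A (quo X)) (cokerm (sq_inc X)) 0 _.
Next Obligation. by move=> X; rewrite (cokermP _).1 comp0c. Qed.

Lemma quo_alpha_beta_cokernel (t : triple A) :
  is_cokernel (fmap quo (alpha t)) (fmap quo (beta t)).
Proof.
have [pj0 pU] := cokermP (tBA t).
have rp : fmap quo (beta t) \oc cokerm (tBA t \oc tCB t) = cokerm (tBA t).
  by rewrite (quo_homE (beta t)) /= compc1.
have mq : fmap quo (alpha t) \oc cokerm (tCB t)
    = cokerm (tBA t \oc tCB t) \oc tBA t.
  exact: (quo_homE (alpha t)).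
split.
  apply: (@cokerm_epic A _ _ (tCB t)); rewrite -compcA mq compcA rp.
  by rewrite pj0 comp0c.
move=> Z h hm0.
have hpj : h \oc cokerm (tBA t \oc tCB t) \oc tBA t = 0.
  by rewrite -compcA -mq compcA hm0 comp0c.
have [u [up uU]] := pU _ _ hpj.
exists u; split=> [|v vr].
  by apply: (@cokerm_epic A _ _ (tBA t \oc tCB t)); rewrite -compcA rp.
by apply: uU; rewrite -rp compcA vr.
Qed.

Lemma quo_alpha_monic (t : triple A) : monic (fmap quo (alpha t)).
Proof.
set m := fmap quo (alpha t).
have mq : m \oc cokerm (tCB t) = cokerm (tBA t \oc tCB t) \oc tBA t.
  exact: (quo_homE (alpha t)).
have nm : monic (imm m) := is_kernel_monic (kermP _).
have [e [ne _]] := (kermP (cokerm m)).2 _ _ (cokermP m).1.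
have ee : epic e := imm_epic ne.
have [qk0 qU] := cokermP (tCB t).
have eqe : epic (e \oc cokerm (tCB t)) by apply: epic_comp => //; exact: cokerm_epic.
have km : monic (tBA t \oc tCB t) by apply: monic_comp; [exact: tBAP|exact: tCBP].
have eqk : is_kernel (e \oc cokerm (tCB t)) (tCB t).
  split=> [|Z h eqh]; first by rewrite -compcA qk0 compc0.
  have [|u [ju _]] := (is_kernel_cokerm km).2 Z (tBA t \oc h).
    by rewrite compcA -mq -ne -!compcA (compcA e) eqh compc0.
  exists u; split=> [|v kv].
    by apply: (@tBAP _ t); rewrite compcA.
  by apply: km; rewrite ju -compcA kv.
have [_ eU] := is_cokernel_kernel eqe eqk.
have [v [vE _]] := eU _ _ qk0.
have ve : v \oc e = idc _.
  by apply: cokerm_epic; rewrite -compcA vE comp1c.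
move=> Z a b; rewrite -ne -!compcA => /nm ab.
by rewrite -(comp1c a) -(comp1c b) -ve -!compcA ab.
Qed.

Lemma quo_short_exact (t : triple A) :
  short_exact (fmap quo (alpha t)) (fmap quo (beta t)).
Proof.
have c := quo_alpha_beta_cokernel t.
split; first exact/exact_monic/quo_alpha_monic.
  exact: exact_cokernel.
exact/exact_epic/is_cokernel_epic/c.
Qed.

(* 0 -> B / C -> A / C -> A / B -> 0. *)
Definition quo_ses (t : triple A) : ses A := Ses (quo_short_exact t).

Section QuoSesHom.
Variables (t t' : triple A).
Variables (c : hom (pBC t) (pBC t')) (d : hom (pAB t) (pAB t')).
Hypothesis e : d \oc beta t \oc alpha t = beta t' \oc alpha t' \oc c.

Lemma quo_ses_top : sq_top d \oc tBA t = tBA t' \oc sq_top c.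
Proof. by have /(congr1 (@sq_top _ _ _)) := e; rewrite /= compc1 comp1c. Qed.

Program Definition quo_mid : hom (pAC t) (pAC t') :=
  @SqHom A (pAC t) (pAC t') (sq_top d) (sq_bot c) _.
Next Obligation.
by rewrite /= compcA quo_ses_top -!compcA (sq_comm c).
Qed.

Program Definition quo_ses_hom : ses_hom (quo_ses t) (quo_ses t') :=
  @SesHom A (quo_ses t) (quo_ses t')
    (fmap quo c) (fmap quo quo_mid) (fmap quo d) _ _.
Next Obligation.
rewrite -!(fmapM quo); congr (fmap quo _); apply: sq_hom_eq => /=.
  exact: quo_ses_top.
by rewrite comp1c compc1.
Qed.
Next Obligation.
rewrite -!(fmapM quo); congr (fmap quo _); apply: sq_hom_eq => /=.
  by rewrite comp1c compc1.
by have /(congr1 (@sq_bot _ _ _)) := e; rewrite /= !compc1.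
Qed.

End QuoSesHom.

Lemma quo_sq0D (X Y : A) (f g : hom X Y) :
  fmap quo (fmap (sq0 A) (f + g))
  = fmap quo (fmap (sq0 A) f) + fmap quo (fmap (sq0 A) g).
Proof.
have E (h : hom X Y) : fmap quo (fmap (sq0 A) h) \oc cokerm (0 : hom zeroob X)
    = cokerm (0 : hom zeroob Y) \oc h by exact: (quo_homE (fmap (sq0 A) h)).
by apply: (@cokerm_epic A _ _ (0 : hom zeroob X)); rewrite compcDl !E compcDr.
Qed.

End Quotient.

Lemma additive_copair_iso (A B : abelian) (F : functor A B) (X Y : A) :
  additive_functor F -> is_iso (copair (fmap F (inj1 X Y)) (fmap F (inj2 X Y))).
Proof.
move=> FD; have F0 (Z W : A) : fmap F (0 : hom Z W) = 0.
  by apply: (addrI (fmap F (0 : hom Z W))); rewrite -FD !addr0.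
have p1i2 (C : abelian) (Z W : C) : prj1 Z W \oc inj2 Z W = 0.
  apply: (addrI (prj1 Z W \oc inj2 Z W)).
  have := congr1 (fun h => prj1 Z W \oc h \oc inj2 Z W) (biprodP Z W).
  rewrite compcDr compcDl compc1 -!compcA prj2_inj2 compc1 compcA prj1_inj1.
  by rewrite comp1c addr0.
have p2i1 (C : abelian) (Z W : C) : prj2 Z W \oc inj1 Z W = 0.
  apply: (addrI (prj2 Z W \oc inj1 Z W)).
  have := congr1 (fun h => prj2 Z W \oc h \oc inj1 Z W) (biprodP Z W).
  rewrite compcDr compcDl compc1 -!compcA prj1_inj1 compc1 (compcA (prj2 _ _)).
  by rewrite prj2_inj2 comp1c addr0.
exists (inj1 _ _ \oc fmap F (prj1 X Y) + inj2 _ _ \oc fmap F (prj2 X Y)).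
rewrite /copair; split.
  rewrite compcDl !compcDr -!(compcA (inj1 _ _)) -!(compcA (inj2 _ _)).
  rewrite !(compcA (fmap F (prj1 X Y))) !(compcA (fmap F (prj2 X Y))) -!fmapM.
  rewrite prj1_inj1 prj2_inj2 p1i2 p2i1 !F0 !fmap1 !comp1c !comp0c !compc0.
  by rewrite addr0 add0r biprodP.
rewrite compcDr !compcDl !(compcA _ (inj1 _ _)) !(compcA _ (inj2 _ _)).
rewrite -!(compcA (fmap F _) _ (inj1 _ _)) -!(compcA (fmap F _) _ (inj2 _ _)).
rewrite prj1_inj1 prj2_inj2 p1i2 p2i1 !compc1 !compc0 !comp0c addr0 add0r.
by rewrite -!fmapM -FD biprodP fmap1.
Qed.

Section HT.
Context {A B : abelian}.

(* H^T_i (A, B) = T_i (A / B). *)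
Program Definition HT_rel (T : hom_functor A B) : rel_homology A B :=
  @RelHomology A B (fun i => functor_comp (T i) (quo A))
    (fun i t => hfbd T i (quo_ses t)) _ _ _ _.
Next Obligation. by move=> T i t t' c d e; exact: (hfbd_nat T i (quo_ses_hom e)). Qed.
Next Obligation. by move=> T i t; exact: (hf_exactA T i (quo_ses t)). Qed.
Next Obligation. by move=> T i t; exact: (hf_exactC T i (quo_ses t)). Qed.
Next Obligation. by move=> T i t; exact: (hf_exactB T i (quo_ses t)). Qed.

Lemma HT_finitely_additive (T : hom_functor A B) :
  finitely_additive (HT_rel T).
Proof.
move=> i X Y.
apply: (@additive_copair_iso A B
  (functor_comp (functor_comp (T i) (quo A)) (sq0 A))) => Z W f g.
by rewrite /= -/(fmap (sq0 A) _) -hf_additive; congr fmap; exact: quo_sq0D.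
Qed.

Definition HT_obj (T : Hom_bd A B) : Hom_add A B :=
  AddHomology (HT_finitely_additive T).

Program Definition HT_hom (T S : Hom_bd A B) (m : hom T S) :
    hom (HT_obj T) (HT_obj S) :=
  @RhHom A B (HT_rel T) (HT_rel S)
    (fun i => @NatTrans (square A) B (HT_rel T i) (HT_rel S i)
       (fun X => hfm m i (quo A X)) _) _.
Next Obligation. by move=> T S m i X Y f; exact: (ntP (hfm m i)). Qed.
Next Obligation. by move=> T S m i t; exact: (hfmP m i (quo_ses t)). Qed.

Program Definition HT : functor (Hom_bd A B) (Hom_add A B) :=
  @Functor (Hom_bd A B) (Hom_add A B) HT_obj HT_hom _ _.
Next Obligation. by move=> T; apply: rh_hom_eq. Qed.
Next Obligation. by move=> T S U n m; apply: rh_hom_eq. Qed.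

Definition bd_homology (H : Hom_add A B) :=
  forall (i : int) (X : square A), is_iso (fmap (ah H i) (sq_proj X)).

End HT.
Arguments HT A B : clear implicits.

(* Main.v *)
(* An object X of A is recovered from H^T as T_i(X) ~ H^T_i(X, 0), through the
   isomorphism X ~ X / 0.  Conversely, for a short exact sequence
   0 -> B -> A -> C -> 0 the triple (A, B, 0) carries the boundary
   H_i(A, B) -> H_{i-1}(B), and in a d-homology the first term is H_i(C); so
   X |-> H_i(X) is an exact d^*-functor.  It is additive because a functor
   compatible with binary direct sums kills the zero object, which forces the
   images of the projections to invert the images of the injections. *)
From mathcomp Require Import all_boot ssralg ssrint.
From mathcomp Require Import boolp.
Require Import Defs.

Set Implicit Arguments.
Unset Strict Implicit.
Unset Printing Implicit Defensive.

Import GRing.Theory.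
Local Open Scope ring_scope.

(** * Isomorphisms and chosen inverses *)

Section Isomorphisms.
Context {C : category}.
Implicit Types X Y Z : C.

Definition inv_of X Y (f : hom X Y) (fi : is_iso f) : hom Y X :=
  projT1 (cid fi).

Lemma inv_ofl X Y (f : hom X Y) (fi : is_iso f) : inv_of fi \oc f = idc X.
Proof. by rewrite /inv_of; case: cid => g []. Qed.

Lemma inv_ofr X Y (f : hom X Y) (fi : is_iso f) : f \oc inv_of fi = idc Y.
Proof. by rewrite /inv_of; case: cid => g []. Qed.

Lemma inv_of_iso X Y (f : hom X Y) (fi : is_iso f) : is_iso (inv_of fi).
Proof. by exists f; rewrite inv_ofl inv_ofr. Qed.

Lemma iso_idc X : is_iso (idc X).
Proof. by exists (idc X); rewrite comp1c. Qed.

Lemma iso_comp X Y Z (g : hom Y Z) (f : hom X Y) :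
  is_iso g -> is_iso f -> is_iso (g \oc f).
Proof.
move=> [g' [gl gr]] [f' [fl fr]]; exists (f' \oc g'); split.
  by rewrite -compcA (compcA g') gl comp1c.
by rewrite -compcA (compcA f) fr comp1c.
Qed.

Lemma iso_monic X Y (f : hom X Y) : is_iso f -> monic f.
Proof.
move=> [g [gf _]] Z u v e.
by rewrite -(comp1c u) -gf -compcA e compcA gf comp1c.
Qed.

Lemma iso_epic X Y (f : hom X Y) : is_iso f -> epic f.
Proof.
move=> [g [_ fg]] Z u v e.
by rewrite -(compc1 u) -fg compcA e -compcA fg compc1.
Qed.

Lemma iso_square X Y X' Y' (f : hom X Y) (f' : hom X' Y')
    (a : hom X X') (b : hom Y Y') :
  is_iso a -> is_iso b -> b \oc f = f' \oc a -> is_iso f -> is_iso f'.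
Proof.
move=> ai bi e fi; have -> : f' = b \oc f \oc inv_of ai.
  by rewrite e -compcA inv_ofr compc1.
by apply: iso_comp; [exact: iso_comp | exact: inv_of_iso].
Qed.

End Isomorphisms.

Lemma fmap_iso (C D : category) (F : functor C D) (X Y : C) (f : hom X Y) :
  is_iso f -> is_iso (fmap F f).
Proof. by move=> [g [gf fg]]; exists (fmap F g); rewrite -!fmapM gf fg !fmap1. Qed.

(** * Exactness, cokernels and biproducts in an abelian category *)

Section Exactness.
Context {A : abelian}.
Implicit Types X Y Z W V : A.

Lemma imm_factor X Y (f : hom X Y) :
  exists2 e : hom X (ker (cokerm f)), imm f \oc e = f & epic e.
Proof.
have [e [fe _]] := (kermP (cokerm f)).2 _ _ (cokermP f).1.
by exists e => //; exact: imm_epic fe.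
Qed.

(** Testing with [k] and [h] avoids the image object, so exactness transports easily along
    isomorphisms. The case [k = cokerm f] already places the kernel of [g] inside the image of
    [f]. *)
Lemma exact_atP X Y Z (f : hom X Y) (g : hom Y Z) :
  exact_at f g <->
  g \oc f = 0 /\ forall W V (k : hom Y W) (h : hom V Y),
    k \oc f = 0 -> g \oc h = 0 -> k \oc h = 0.
Proof.
have [e fe ee] := imm_factor f; split=> [[g0 gU]|[gf0 kh]].
  split=> [|W V k h kf0 /gU [u [<- _]]]; first by rewrite -fe compcA g0 comp0c.
  have [k' [<- _]] := (cokermP f).2 _ _ kf0.
  by rewrite -compcA (compcA (cokerm f)) (kermP (cokerm f)).1 comp0c compc0.
split=> [|V h gh0]; first by apply: (epic0 ee); rewrite -compcA fe.
by apply: (kermP (cokerm f)).2; apply: kh gh0; exact: (cokermP f).1.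
Qed.

Lemma exact_iso X Y Z X' Y' Z' (f : hom X Y) (g : hom Y Z)
    (f' : hom X' Y') (g' : hom Y' Z')
    (a : hom X X') (b : hom Y Y') (c : hom Z Z') :
  is_iso a -> is_iso b -> is_iso c ->
  b \oc f = f' \oc a -> c \oc g = g' \oc b -> exact_at f g -> exact_at f' g'.
Proof.
move=> ai bi ci ef eg /exact_atP [gf0 H]; apply/exact_atP; split.
  apply: (epic0 (iso_epic ai)).
  by rewrite -compcA -ef compcA -eg -compcA gf0 compc0.
move=> W V k h kf0 gh0.
rewrite -(comp1c h) -(inv_ofr bi) -compcA compcA; apply: H.
  by rewrite -compcA ef compcA kf0 comp0c.
apply: (monic0 (iso_monic ci)).
by rewrite compcA eg -compcA (compcA b) inv_ofr comp1c.
Qed.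

Lemma short_exact_monic X Y Z (f : hom X Y) (g : hom Y Z) :
  short_exact f g -> monic f.
Proof.
move=> [/exact_atP [_ H] _ _].
suff f0 V (h : hom V X) : f \oc h = 0 -> h = 0.
  move=> V u v uv; apply/eqP; rewrite -subr_eq0; apply/eqP/f0.
  by rewrite compcDr compcN uv subrr.
(* The test morphism [k] is the identity of [X]. *)
by move=> fh0; rewrite -(comp1c h); apply: H => //; exact: compc0.
Qed.

(** Exactness at [Z] makes [g] epic, hence a cokernel of its kernel [imm f]; as [f] is [imm f] after
    an epi, both are killed by the same morphisms. *)
Lemma short_exact_cokernel X Y Z (f : hom X Y) (g : hom Y Z) :
  short_exact f g -> is_cokernel f g.
Proof.
move=> [_ fg /exact_atP [_ H]].
have ge : epic g.
  move=> W u v uv; apply/eqP; rewrite -subr_eq0; apply/eqP.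
  rewrite -[_ - _]compc1; apply: H; last exact: to_zero.
  by rewrite compcDl compNc uv subrr.
have [_ gU] := is_cokernel_kernel ge fg; have [e fe ee] := imm_factor f.
split=> [|W h hf0]; first by case/exact_atP: fg.
by apply: gU; apply: (epic0 ee); rewrite -compcA fe.
Qed.

Lemma cokernel_iso X Y Q Q' (f : hom X Y) (q : hom Y Q) (q' : hom Y Q')
    (u : hom Q Q') :
  is_cokernel f q -> is_cokernel f q' -> u \oc q = q' -> is_iso u.
Proof.
move=> cq cq' uq; have [v [vq' _]] := cq'.2 _ _ cq.1.
exists v; split.
  by apply: (is_cokernel_epic cq); rewrite -compcA uq vq' comp1c.
by apply: (is_cokernel_epic cq'); rewrite -compcA vq' uq comp1c.
Qed.

Lemma cokerm0_iso X : is_iso (cokerm (0 : hom zeroob X)).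
Proof.
apply: (cokernel_iso (q := idc X) _ (cokermP _)); last exact: compc1.
by split=> [|Z h _]; [exact: compc0 | exists h; split=> [|v <-]; rewrite compc1].
Qed.

Lemma prj1_inj2 X Y : prj1 X Y \oc inj2 X Y = 0.
Proof.
apply: (addrI (prj1 X Y \oc inj2 X Y)).
have := congr1 (fun h => prj1 X Y \oc h \oc inj2 X Y) (biprodP X Y).
rewrite /= compcDr compcDl compc1 -!compcA prj2_inj2 compc1 compcA prj1_inj1.
by rewrite comp1c addr0.
Qed.

Lemma prj2_inj1 X Y : prj2 X Y \oc inj1 X Y = 0.
Proof.
apply: (addrI (prj2 X Y \oc inj1 X Y)).
have := congr1 (fun h => prj2 X Y \oc h \oc inj1 X Y) (biprodP X Y).
rewrite /= compcDr compcDl compc1 -!compcA prj1_inj1 compc1 (compcA (prj2 _ _)).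
by rewrite prj2_inj2 comp1c addr0.
Qed.

Lemma copair_inj1 X Y Z (f : hom X Z) (g : hom Y Z) :
  copair f g \oc inj1 X Y = f.
Proof.
by rewrite /copair compcDl -!compcA prj1_inj1 prj2_inj1 compc1 compc0 addr0.
Qed.

Lemma copair_inj2 X Y Z (f : hom X Z) (g : hom Y Z) :
  copair f g \oc inj2 X Y = g.
Proof.
by rewrite /copair compcDl -!compcA prj2_inj2 prj1_inj2 compc1 compc0 add0r.
Qed.

Lemma copair_ext X Y Z (u v : hom (biprod X Y) Z) :
  u \oc inj1 X Y = v \oc inj1 X Y -> u \oc inj2 X Y = v \oc inj2 X Y -> u = v.
Proof.
by move=> e1 e2; rewrite -(compc1 u) -(compc1 v) -biprodP !compcDr !compcA e1 e2.
Qed.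

End Exactness.

(** * Functors preserving binary direct sums are additive *)

Section AdditiveFromCopair.
Context {A B : abelian} (F : functor A B).
Hypothesis copairF :
  forall X Y : A, is_iso (copair (fmap F (inj1 X Y)) (fmap F (inj2 X Y))).

Lemma copair_iso_zero : idc (F (zeroob : A)) = 0.
Proof.
(* Both injections 0 -> 0 + 0 agree, so the injective copair identifies the
   two injections of F 0. *)
have e : inj1 (F zeroob) (F zeroob) = inj2 (F (zeroob : A)) (F zeroob).
  apply: (iso_monic (copairF zeroob zeroob)); rewrite copair_inj1 copair_inj2.
  by congr fmap; rewrite [LHS]from_zero [RHS]from_zero.
by rewrite -(prj1_inj1 _ (F zeroob)) e prj1_inj2.
Qed.

Lemma copair_iso_fmap0 (X Y : A) : fmap F (0 : hom X Y) = 0.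
Proof.
rewrite -(comp0c Y (0 : hom X zeroob)) fmapM.
by rewrite -(compc1 (fmap F (0 : hom zeroob Y))) copair_iso_zero compc0 comp0c.
Qed.

(** The invertible copair makes the images of the injections jointly epic; on each of them the cross
    term is the image of a zero morphism, hence zero. *)
Lemma copair_iso_biprodP (X Y : A) :
  fmap F (inj1 X Y) \oc fmap F (prj1 X Y)
    + fmap F (inj2 X Y) \oc fmap F (prj2 X Y) = idc (F (biprod X Y)).
Proof.
apply: (iso_epic (copairF X Y)); rewrite comp1c.
apply: copair_ext; rewrite -compcA ?copair_inj1 ?copair_inj2 compcDl -!compcA.
  by rewrite -!fmapM prj1_inj1 prj2_inj1 compc1 compc0 copair_iso_fmap0 addr0.
by rewrite -!fmapM prj2_inj2 prj1_inj2 compc1 compc0 copair_iso_fmap0 add0r.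
Qed.

(** The sum [f + g] is the diagonal of [X] followed by [copair f g]; the decomposed identity of
    [F (biprod X X)] is inserted between the two. *)
Lemma copair_iso_additive : additive_functor F.
Proof.
move=> X Y f g.
have -> : f + g = copair f g \oc (inj1 X X + inj2 X X).
  by rewrite compcDr copair_inj1 copair_inj2.
have p1 : prj1 X X \oc (inj1 X X + inj2 X X) = idc X.
  by rewrite compcDr prj1_inj1 prj1_inj2 addr0.
have p2 : prj2 X X \oc (inj1 X X + inj2 X X) = idc X.
  by rewrite compcDr prj2_inj2 prj2_inj1 add0r.
rewrite fmapM -(compc1 (fmap F (copair f g))) -copair_iso_biprodP.
rewrite compcDr compcDl !compcA -!fmapM copair_inj1 copair_inj2.
by rewrite !fmapM -!compcA -!fmapM p1 p2 !compc1.
Qed.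

End AdditiveFromCopair.

(** * Passing between short exact sequences and triples *)

Section SesTriple.
Context {A : abelian}.

Lemma quo_proj (X : square A) :
  fmap (quo A) (sq_proj X) = cokerm (0 : hom zeroob (quo A X)).
Proof.
by apply: (@cokerm_epic A _ _ (sq_inc X)); exact: (quo_homE (sq_proj X)).
Qed.

Lemma quo_proj_iso (X : square A) : is_iso (fmap (quo A) (sq_proj X)).
Proof. by rewrite quo_proj; exact: cokerm0_iso. Qed.

Lemma sq_proj_nat (X Y : square A) (f : hom X Y) :
  sq_proj Y \oc f = fmap (sq0 A) (fmap (quo A) f) \oc sq_proj X.
Proof.
apply: sq_hom_eq => /=; first by rewrite (quo_homE f).
by rewrite comp1c comp0c.
Qed.

(** The inclusion of 0 is the one used by [sq0], so that [pBC] of this triple is convertible to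
    [sq0 A (sesB s)]. *)
Definition ses_triple (s : ses A) : triple A :=
  Triple (short_exact_monic (sesP s)) (@zero_monic A (sesB s) 0).

Lemma sesp_sesi (s : ses A) : sesp s \oc sesi s = 0.
Proof. by case: (short_exact_cokernel (sesP s)). Qed.

Lemma ses_proj_subproof (s : ses A) :
  sesp s \oc sq_inc (pAB (ses_triple s))
  = sq_inc (sq0 A (sesC s)) \oc (0 : hom (sesB s) zeroob).
Proof. by rewrite /= sesp_sesi compc0. Qed.

(* (A, B) -> (C, 0). *)
Definition ses_proj (s : ses A) :
    hom (pAB (ses_triple s)) (sq0 A (sesC s)) :=
  @SqHom A (pAB (ses_triple s)) (sq0 A (sesC s)) _ _ (ses_proj_subproof s).

Definition ses_quo (s : ses A) : hom (quo A (pAB (ses_triple s))) (sesC s) :=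
  @cokdesc A _ _ (sesi s) _ (sesp s) (sesp_sesi s).

Lemma ses_quo_iso (s : ses A) : is_iso (ses_quo s).
Proof.
apply: (cokernel_iso (cokermP (sesi s)) (short_exact_cokernel (sesP s))).
exact: cokdescK.
Qed.

(** Through this factorization a homology that inverts every [sq_proj] also inverts [ses_proj]. *)
Lemma ses_projE (s : ses A) :
  ses_proj s = fmap (sq0 A) (ses_quo s) \oc sq_proj (pAB (ses_triple s)).
Proof.
apply: sq_hom_eq => /=; last by rewrite comp1c.
by rewrite /ses_quo cokdescK.
Qed.

(* The pair (A, 0) of the triple of s has inclusion [sesi s \oc 0], which is
   equal but not convertible to the inclusion of [sq0 A (sesA s)]. *)
Lemma ses_mid_subproof (s : ses A) :
  idc (sesA s) \oc sq_inc (pAC (ses_triple s))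
  = sq_inc (sq0 A (sesA s)) \oc idc zeroob.
Proof. by rewrite /= comp1c compc0 comp0c. Qed.

Definition ses_mid (s : ses A) :
    hom (pAC (ses_triple s)) (sq0 A (sesA s)) :=
  @SqHom A (pAC (ses_triple s)) (sq0 A (sesA s)) _ _ (ses_mid_subproof s).

Lemma ses_mid_iso (s : ses A) : is_iso (ses_mid s).
Proof.
have e : idc (sesA s) \oc sq_inc (sq0 A (sesA s))
    = sq_inc (pAC (ses_triple s)) \oc idc zeroob.
  by rewrite /= comp1c compc0 comp0c.
by exists (@SqHom A (sq0 A (sesA s)) (pAC (ses_triple s)) _ _ e); split;
   apply: sq_hom_eq => /=; rewrite comp1c.
Qed.

Lemma ses_mid_alpha (s : ses A) :
  ses_mid s \oc alpha (ses_triple s) = fmap (sq0 A) (sesi s).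
Proof. by apply: sq_hom_eq; rewrite /= comp1c. Qed.

Lemma ses_proj_beta (s : ses A) :
  ses_proj s \oc beta (ses_triple s) = fmap (sq0 A) (sesp s) \oc ses_mid s.
Proof.
apply: sq_hom_eq => /=; first by rewrite !compc1.
by rewrite [LHS]to_zero [RHS]to_zero.
Qed.

Section Morphism.
Variables (s s' : ses A) (u : ses_hom s s').

Definition ses_pair_hom : hom (pAB (ses_triple s)) (pAB (ses_triple s')) :=
  @SqHom A (pAB (ses_triple s)) (pAB (ses_triple s')) (shA u) (shB u) (shi u).

Lemma ses_pair_hom_compat :
  ses_pair_hom \oc beta (ses_triple s) \oc alpha (ses_triple s)
  = beta (ses_triple s') \oc alpha (ses_triple s') \oc fmap (sq0 A) (shB u).
Proof.
apply: sq_hom_eq => /=.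
  by rewrite compc1 comp1c (shi u).
by rewrite !compc1 compc0.
Qed.

Lemma ses_proj_nat :
  ses_proj s' \oc ses_pair_hom = fmap (sq0 A) (shC u) \oc ses_proj s.
Proof.
apply: sq_hom_eq => /=; first by rewrite (shp u).
by rewrite comp1c comp0c.
Qed.

End Morphism.

(* The comparison of s with 0 -> B / 0 -> A / 0 -> A / B -> 0. *)
Lemma ses_hom_quo_ses (s : ses A) :
  exists u : ses_hom s (quo_ses (ses_triple s)), is_iso (shB u).
Proof.
have [w [wp _]] := (short_exact_cokernel (sesP s)).2 _ _ (cokermP (sesi s)).1.
set t := ses_triple s.
have i0 : cokerm (tBA t \oc tCB t) \oc tBA t
    = fmap (quo A) (alpha t) \oc cokerm (tCB t).
  by rewrite (quo_homE (alpha t)).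
have p0 : w \oc sesp s = fmap (quo A) (beta t) \oc cokerm (tBA t \oc tCB t).
  by rewrite wp (quo_homE (beta t)) /= compc1.
exists (@SesHom A s (quo_ses t) (cokerm (tCB t)) _ w i0 p0).
exact: cokerm0_iso.
Qed.

(* The morphism of triples (A, B, C) -> (A / C, B / C, 0). *)
Lemma quo_pair_subproof (t : triple A) :
  cokerm (sq_inc (pAC t)) \oc sq_inc (pAB t)
  = sq_inc (pAB (ses_triple (quo_ses t))) \oc cokerm (tCB t).
Proof. exact: esym (quo_homE (alpha t)). Qed.

Definition quo_pair (t : triple A) :
    hom (pAB t) (pAB (ses_triple (quo_ses t))) :=
  @SqHom A (pAB t) (pAB (ses_triple (quo_ses t))) _ _ (quo_pair_subproof t).

(** This is the condition under which the boundary of a relative homology is natural from [t] to the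
    triple of its quotient sequence. *)
Lemma quo_pair_compat (t : triple A) :
  quo_pair t \oc beta t \oc alpha t
  = beta (ses_triple (quo_ses t)) \oc alpha (ses_triple (quo_ses t))
      \oc sq_proj (pBC t).
Proof.
apply: sq_hom_eq => /=.
  by rewrite compc1 comp1c; exact: esym (quo_homE (alpha t)).
by rewrite !compc1 (cokermP _).1 comp0c.
Qed.

Lemma ses_proj_quo_pair (t : triple A) :
  ses_proj (quo_ses t) \oc quo_pair t = sq_proj (pAB t).
Proof.
apply: sq_hom_eq; last by rewrite /= comp0c.
by rewrite /= -[RHS]compc1 -(quo_homE (beta t)).
Qed.

End SesTriple.

(** * Full faithfulness *)

Section FullyFaithful.
Context {A B : abelian}.
Variables T S : hom_functor A B.

Let unit (X : A) : hom X (quo A (sq0 A X)) := cokerm (0 : hom zeroob X).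

Let unit_iso (F : functor A B) (X : A) : is_iso (fmap F (unit X)).
Proof. exact/fmap_iso/cokerm0_iso. Qed.

(** By naturality along the isomorphism from [X] to X/0, a component at [X] is determined by the one
    at X/0, which is the component of [HT_hom] at (X, 0). *)
Lemma HT_faithful (m n : hf_hom T S) : HT_hom m = HT_hom n -> m = n.
Proof.
move=> e; apply: hf_hom_eq => i X.
have eX : m i (quo A (sq0 A X)) = n i (quo A (sq0 A X)).
  exact: (congr1 (fun k : rh_hom (HT_rel T) (HT_rel S) => k i (sq0 A X)) e).
by apply: (iso_monic (unit_iso (S i) X)); rewrite -!ntP eX.
Qed.

Section Full.
Variable g : rh_hom (HT_rel T) (HT_rel S).

(** A retyping of [g] that displays the functors [T i] and [S i], so that rewriting applies. *)
Let gq i (X : square A) : hom (T i (quo A X)) (S i (quo A X)) := g i X.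

Let gq_nat i (X Y : square A) (f : hom X Y) :
  gq i Y \oc fmap (T i) (fmap (quo A) f) = fmap (S i) (fmap (quo A) f) \oc gq i X.
Proof. exact: (ntP (g i)). Qed.

Definition full_component i (X : A) : hom (T i X) (S i X) :=
  inv_of (unit_iso (S i) X) \oc gq i (sq0 A X) \oc fmap (T i) (unit X).

Lemma full_componentE i X :
  fmap (S i) (unit X) \oc full_component i X
  = gq i (sq0 A X) \oc fmap (T i) (unit X).
Proof. by rewrite /full_component !compcA inv_ofr comp1c. Qed.

Lemma full_component_nat i (X Y : A) (f : hom X Y) :
  full_component i Y \oc fmap (T i) f = fmap (S i) f \oc full_component i X.
Proof.
have uf : unit Y \oc f = fmap (quo A) (fmap (sq0 A) f) \oc unit X.
  by rewrite (quo_homE (fmap (sq0 A) f)).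
apply: (iso_monic (unit_iso (S i) Y)).
rewrite compcA full_componentE -compcA -fmapM uf fmapM compcA gq_nat.
by rewrite -compcA -full_componentE !compcA -!fmapM uf.
Qed.

Definition full_nat i : nat_trans (T i) (S i) :=
  NatTrans (full_component_nat i).

(** The unit at A/B is the quotient of the projection (A, B) -> (A/B, 0), and [g] is natural along
    that projection. *)
Lemma full_nat_quo i (X : square A) : full_nat i (quo A X) = gq i X.
Proof.
apply: (iso_monic (unit_iso (S i) (quo A X))); rewrite full_componentE.
by rewrite /unit -quo_proj gq_nat.
Qed.

(** For the sequence of a triple this is the compatibility of [g] with boundaries; any [s] maps to
    such a sequence, and the isomorphism on the subobjects can be cancelled on the left. *)
Lemma full_nat_bd i (s : ses A) :
  full_nat (i - 1) (sesB s) \oc hfbd T i s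
  = hfbd S i s \oc full_nat i (sesC s).
Proof.
have [u ui] := ses_hom_quo_ses s; set t := ses_triple s in u ui.
have gt : full_nat (i - 1) (sesB (quo_ses t)) \oc hfbd T i (quo_ses t)
    = hfbd S i (quo_ses t) \oc full_nat i (sesC (quo_ses t)).
  rewrite (full_nat_quo _ (pBC t)) (full_nat_quo _ (pAB t)).
  exact: (rhmP g i t).
apply: (iso_monic (fmap_iso (S (i - 1)) ui)).
rewrite compcA -ntP -compcA (hfbd_nat T i u) compcA gt -compcA ntP compcA.
by rewrite -(hfbd_nat S i u) -compcA.
Qed.

Lemma HT_full : exists m : hf_hom T S, HT_hom m = g.
Proof.
by exists (HfHom full_nat_bd); apply: rh_hom_eq => i X; exact: full_nat_quo.
Qed.

End Full.

End FullyFaithful.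

(** * The essential image *)

Section EssentialImage.
Context {A B : abelian}.

Lemma bd_homology_HT (T : Hom_bd A B) : bd_homology (HT A B T).
Proof. by move=> i X; apply: (fmap_iso (hf T i)); exact: quo_proj_iso. Qed.

(** Inverses taken componentwise are again natural and commute with the boundaries. *)
Lemma rh_hom_iso (H K : Hom_add A B) (m : hom H K) :
  is_iso m <-> forall i X, is_iso (rhm m i X).
Proof.
split=> [[n [nm mn]] i X|mi].
  exists (rhm n i X); split.
    exact: (congr1 (fun k : rh_hom (ah H) (ah H) => k i X) nm).
  exact: (congr1 (fun k : rh_hom (ah K) (ah K) => k i X) mn).
have nP i (X Y : square A) (f : hom X Y) :
    inv_of (mi i Y) \oc fmap (ah K i) f = fmap (ah H i) f \oc inv_of (mi i X).
  apply: (iso_monic (mi i Y)); apply: (iso_epic (mi i X)).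
  rewrite compcA inv_ofr comp1c -!compcA inv_ofl compc1.
  by rewrite ntP.
have bdP i t :
    inv_of (mi (i - 1) (pBC t)) \oc rhbd (ah K) i t
    = rhbd (ah H) i t \oc inv_of (mi i (pAB t)).
  apply: (iso_monic (mi (i - 1) (pBC t))); apply: (iso_epic (mi i (pAB t))).
  rewrite compcA inv_ofr comp1c -!compcA inv_ofl compc1.
  by rewrite rhmP.
exists (@RhHom A B K H (fun i => NatTrans (@nP i)) bdP).
by split; apply: rh_hom_eq => i X /=; rewrite ?inv_ofl ?inv_ofr.
Qed.

Lemma bd_homology_isomorphic (H K : Hom_add A B) :
  isomorphic H K -> bd_homology H -> bd_homology K.
Proof.
move=> [m /rh_hom_iso mi] Hbd i X.
exact: iso_square (mi i X) (mi i _) (ntP (rhm m i) (sq_proj X)) (Hbd i X).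
Qed.

(** * The exact functor realizing a given homology *)

Section Realization.
Variables (H : add_homology A B) (Hbd : bd_homology H).

Lemma fmap_ses_proj_iso i (s : ses A) : is_iso (fmap (H i) (ses_proj s)).
Proof.
rewrite ses_projE fmapM; apply: iso_comp; last exact: Hbd.
exact/fmap_iso/fmap_iso/ses_quo_iso.
Qed.

Let T i : functor A B := functor_comp (H i) (sq0 A).

(** The boundary of [H] for the triple (A, B, 0), read through the isomorphism of H_i(A, B) with
    H_i(C). *)
Let bd i (s : ses A) : hom (T i (sesC s)) (T (i - 1) (sesB s)) :=
  rhbd H i (ses_triple s) \oc inv_of (fmap_ses_proj_iso i s).

Let bdE i s : bd i s \oc fmap (H i) (ses_proj s) = rhbd H i (ses_triple s).
Proof. by rewrite /bd -compcA inv_ofl compc1. Qed.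

Lemma realization_additive i : additive_functor (T i).
Proof. by apply: copair_iso_additive => X Y; exact: (@ahP A B H i X Y). Qed.

Lemma realization_bd_nat i (s s' : ses A) (u : ses_hom s s') :
  fmap (T (i - 1)) (shB u) \oc bd i s = bd i s' \oc fmap (T i) (shC u).
Proof.
apply: (iso_epic (fmap_ses_proj_iso i s)).
rewrite -compcA bdE -compcA /= -fmapM -ses_proj_nat fmapM compcA bdE.
exact: (rhbd_nat H i (ses_pair_hom_compat u)).
Qed.

(** Here and in the next two lemmas, the exact sequence of [H] for (A, B, 0) is carried over by the
    isomorphisms induced by [ses_mid] and [ses_proj]. *)
Lemma realization_exactA i s :
  exact_at (fmap (T i) (sesi s)) (fmap (T i) (sesp s)).
Proof.
apply: (exact_iso (iso_idc _) (fmap_iso (H i) (ses_mid_iso s))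
          (fmap_ses_proj_iso i s) _ _ (rh_exactAC H i (ses_triple s))).
  by rewrite compc1 -fmapM ses_mid_alpha.
by rewrite -!fmapM ses_proj_beta.
Qed.

Lemma realization_exactC i s : exact_at (fmap (T i) (sesp s)) (bd i s).
Proof.
apply: (exact_iso (fmap_iso (H i) (ses_mid_iso s)) (fmap_ses_proj_iso i s)
          (iso_idc _) _ _ (rh_exactAB H i (ses_triple s))).
  by rewrite -!fmapM ses_proj_beta.
by rewrite comp1c bdE.
Qed.

Lemma realization_exactB i s : exact_at (bd i s) (fmap (T (i - 1)) (sesi s)).
Proof.
apply: (exact_iso (fmap_ses_proj_iso i s) (iso_idc _)
          (fmap_iso (H (i - 1)) (ses_mid_iso s)) _ _
          (rh_exactBC H i (ses_triple s))).
  by rewrite comp1c bdE.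
by rewrite compc1 -fmapM ses_mid_alpha.
Qed.

Definition realization : hom_functor A B :=
  HomFunctor realization_additive realization_bd_nat realization_exactA
    realization_exactC realization_exactB.

Lemma realization_proj_nat i (X Y : square A) (f : hom X Y) :
  fmap (H i) (sq_proj Y) \oc fmap (H i) f
  = fmap (HT_rel realization i) f \oc fmap (H i) (sq_proj X).
Proof. by rewrite /= -!fmapM sq_proj_nat. Qed.

Lemma realization_proj_bd i (t : triple A) :
  fmap (H (i - 1)) (sq_proj (pBC t)) \oc rhbd H i t
  = rhbd (HT_rel realization) i t \oc fmap (H i) (sq_proj (pAB t)).
Proof.
(* Naturality moves the boundary to the triple (A/C, B/C, 0), whose boundary defines [bd] on the
   quotient sequence. *)
rewrite (rhbd_nat H i (quo_pair_compat t)) -bdE -compcA -fmapM.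
by rewrite ses_proj_quo_pair.
Qed.

(** The canonical projections form a morphism out of [H], invertible by [Hbd]; its inverse has the
    required direction. *)
Lemma realization_isomorphic : isomorphic (HT A B realization) H.
Proof.
pose m : @hom (Hom_add A B) H (HT A B realization) :=
  @RhHom A B H (HT_rel realization)
    (fun i => @NatTrans (square A) B (H i) (HT_rel realization i)
       (fun X => fmap (H i) (sq_proj X)) (@realization_proj_nat i))
    realization_proj_bd.
have mi : is_iso m by apply/rh_hom_iso => i X; exact: Hbd.
by exists (inv_of mi); exact: inv_of_iso.
Qed.

End Realization.

End EssentialImage.

Theorem lemma4p1p2 (A B : abelian) :
  fully_faithful (HT A B) /\
  (forall H : Hom_add A B,
     in_essential_image (HT A B) H <-> bd_homology H).
Proof.
split; first by split; [exact: HT_full | exact: HT_faithful].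
move=> H; split=> [[T TH]|Hbd].
  exact: bd_homology_isomorphic TH (bd_homology_HT T).
by exists (realization Hbd); exact: realization_isomorphic.
Qed.
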